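(* Let $\mathcal H$ be an infinite-dimensional separable Hilbert space, assume that $T:\mathcal H\to\mathcal H$ is a compact linear operator, and let $\varphi_1,\dots,\varphi_J\in\mathcal H$ (a finite collection of vectors). Then $\bigcup_{j=1}^J\{T^n\varphi_j\}_{n=0}^\infty$ cannot be a frame for $\mathcal H$.
   Context: A countable family $\{f_i\}_{i\in I}$ in $\mathcal H$ is a frame for $\mathcal H$ if there exist constants $A,B>0$ such that $A\|f\|^2\le\sum_{i\in I}|\langle f,f_i\rangle|^2\le B\|f\|^2$ for all $f\in\mathcal H$. The union $\bigcup_{j=1}^J\{T^n\varphi_j\}_{n=0}^\infty$ is the family indexed by $(j,n)\in\{1,\dots,J\}\times\{0,1,2,\dots\}$. *)

(* Defs.v *)
From HB Require Import structures.
From mathcomp Require Import all_boot all_order all_algebra.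
From mathcomp Require Import sesquilinear complex.
From mathcomp Require Import all_classical all_reals all_analysis.

Set Implicit Arguments.
Unset Strict Implicit.
Unset Printing Implicit Defensive.

Import Order.TTheory GRing.Theory Num.Theory.
Import numFieldNormedType.Exports.

Local Open Scope classical_set_scope.
Local Open Scope complex_scope.
Local Open Scope ring_scope.

(* The scalars of a Hilbert space are either the reals or the complex numbers
   over R, with their conjugation. In MathComp-Analysis the norm of a
   K-normed module is K-valued; re turns norms into elements of R. *)
Variant scalar_field (R : realType) :
    forall K : numFieldType, involutive_rmorphism K -> (K -> R) -> Prop :=
| RealScalars : @scalar_field R R idfun idfun
| ComplexScalars : @scalar_field R R[i] Num.conj (@complex.Re R).

(* Together with H : completeNormedModType K, this makes H a Hilbert space:
   its norm is the one induced by the inner product dot, which is linear in its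
   first argument. *)
Definition induces_norm (K : numFieldType) (conj : K -> K)
    (H : normedModType K) (dot : {dot H for conj}) : Prop :=
  forall x : H, `|x| ^+ 2 = dot x x.

Definition finite_dimensional (K : numFieldType) (H : lmodType K) : Prop :=
  exists (n : nat) (e : 'I_n -> H),
    forall x : H, exists c : 'I_n -> K, x = \sum_(i < n) c i *: e i.

Definition separable (X : topologicalType) : Prop :=
  exists2 D : set X, countable D & dense D.

Definition compact_operator (K : numFieldType) (U V : normedModType K)
    (T : {linear U -> V}) : Prop :=
  forall A : set U, bounded_set A -> precompact (T @` A).

Definition is_frame (R : realType) (K : numFieldType) (conj : K -> K)
    (re : K -> R) (H : normedModType K) (dot : {dot H for conj})
    (I : countType) (g : I -> H) : Prop :=
  exists A B : R, [/\ 0 < A, 0 < B & forall f : H,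
    let S := (\esum_(i in [set: I]) (re `|dot f (g i)| ^+ 2)%:E)%E in
    ((A * re `|f| ^+ 2)%:E <= S)%E /\ (S <= (B * re `|f| ^+ 2)%:E)%E].

(* Main.v *)
Require Import Defs.
From HB Require Import structures.
From mathcomp Require Import all_boot all_order all_algebra.
From mathcomp Require Import sesquilinear complex.
From mathcomp Require Import all_classical all_reals all_analysis.
From mathcomp Require Import ring.

Set Implicit Arguments.
Unset Strict Implicit.
Unset Printing Implicit Defensive.

Import Order.TTheory GRing.Theory Num.Theory.
Import numFieldNormedType.Exports.

Local Open Scope classical_set_scope.
Local Open Scope ring_scope.


(** Let g_(j,n) = T^n phi_j be the family, with frame bounds A and B. Shifting
    the family gives T g_(j,n) = g_(j,n+1), so if f is orthogonal to every
    phi_j, then the frame sum of f is the sum of |<f, T g_i>|^2 over all i.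
    Compactness of T makes this sum much smaller than |f|^2 for a suitable f,
    which contradicts the lower bound A |f|^2.

    For the choice of f, let e > 0. The image of the unit ball under T lies
    within e of a finite set of points (compact_operator_net). Since H has
    infinite dimension, some f <> 0 is orthogonal to these points and to all
    phi_j (exists_orthogonal). Then |<f, T x>| <= e |f| |x| for all x
    (compact_operator_small); in terms of the adjoint, T^* f is small.

    The upper frame bound, applied to T^* f, would now bound the sum by
    B e^2 |f|^2. A duality argument gives the same bound without the adjoint
    (image_coefficients_bound): over a finite set of indices, put
    c_i = <f, T g_i> and y = \sum_i c_i g_i. The sum S of the |c_i|^2 is
    <f, T y>, hence S <= e |f| |y|, while |y|^2 <= B S because the synthesis
    map obeys the upper frame bound (synthesis_bound). Therefore
    S <= B e^2 |f|^2, and it remains to take e with e^2 B < A.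

    The argument is carried out in the scalar field K, in which the norms take
    their values; frame_bounds translates the real frame inequalities. *)

(** Treats the real and the complex case at once: re inverts, on the real
    elements of K, an ordered embedding of R into K, so real inequalities
    about norms can be moved to K. *)
Lemma scalar_field_embedding (R : realType) (K : numFieldType)
    (conj : involutive_rmorphism K) (re : K -> R) :
  scalar_field conj re ->
  exists iota : {rmorphism R -> K},
    [/\ {mono iota : x y / x <= y},
        forall x, x \is Num.real -> iota (re x) = x
      & forall x, x * conj x = `|x| ^+ 2].
Proof.
case.
  exists idfun; split => // x; by rewrite /= real_normK ?num_real// expr2.
exists (real_complex R); split => //.
- by move=> x y; exact: lecR.
- exact: RRe_real.
- by move=> x; rewrite normCK.
Qed.

Section InnerProduct.
Variables (K : numFieldType) (conj : involutive_rmorphism K).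
Hypothesis conjE : forall x, x * conj x = `|x| ^+ 2.

Lemma norm_conj x : `|conj x| = `|x|.
Proof.
have [->|x0] := eqVneq x 0; first by rewrite rmorph0.
apply: (mulfI (x := `|x|)); first by rewrite normr_eq0.
by rewrite -normrM conjE normrX normr_id expr2.
Qed.

Variables (H : normedModType K) (dot : {dot H for conj}).
Hypothesis hdot : induces_norm dot.

Lemma dotC x y : dot x y = conj (dot y x).
Proof. by have := @hermC _ _ _ _ dot x y; rewrite expr0 mul1r. Qed.

Lemma norm_dotC x y : `|dot x y| = `|dot y x|.
Proof. by rewrite dotC norm_conj. Qed.

Lemma cauchy_schwarz x y : `|dot x y| <= `|x| * `|y|.
Proof.
have [->|y0] := eqVneq y 0; first by rewrite linear0r !normr0 mulr0.
have ny : 0 < `|y| ^+ 2 by rewrite exprn_gt0// normr_gt0.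
pose z := x - (dot x y / `|y| ^+ 2) *: y.
have zy : dot z y = 0.
  by rewrite linearBl linearZl_LR /= -hdot divfK ?subrr// gt_eqF.
have zz : `|z| ^+ 2 = `|x| ^+ 2 - `|dot x y| ^+ 2 / `|y| ^+ 2.
  rewrite hdot {2}/z linearBr linearZr_LR /= zy mulr0 subr0.
  rewrite linearBl linearZl_LR /= -hdot (dotC y x) mulrAC conjE //.
rewrite -ler_sqr ?nnegrE ?mulr_ge0// exprMn.
by rewrite -ler_pdivrMr// -subr_ge0 -zz exprn_ge0.
Qed.

(** A Bessel inequality for the coefficients of vectors bounds the synthesis map
    by the same constant: expand |y|^2 = \sum_i c_i <g_i, y> and separate the
    factors by the inequality of means
    2 |c_i| |<g_i, y>| <= b |c_i|^2 + |<g_i, y>|^2 / b, whose second terms sum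
    to at most |y|^2. *)
Lemma synthesis_bound (I : Type) (s : seq I) (g : I -> H) (b : K)
    (b0 : 0 < b)
    (bessel : forall x, \sum_(i <- s) `|dot x (g i)| ^+ 2 <= b * `|x| ^+ 2)
    (c : I -> K) :
  `|\sum_(i <- s) c i *: g i| ^+ 2 <= b * \sum_(i <- s) `|c i| ^+ 2.
Proof.
set y := \sum_(i <- s) _.
have amgm (u v : K) : 0 <= u -> 0 <= v ->
    u * v *+ 2 <= b * u ^+ 2 + b^-1 * v ^+ 2.
  move=> u0 v0; rewrite -subr_ge0.
  have -> : b * u ^+ 2 + b^-1 * v ^+ 2 - u * v *+ 2 = b^-1 * (b * u - v) ^+ 2.
    by field; rewrite gt_eqF.
  rewrite mulr_ge0 ?invr_ge0 ?(ltW b0)// real_exprn_even_ge0//.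
  by rewrite realB// ger0_real// mulr_ge0// ltW.
have yE : `|y| ^+ 2 <= \sum_(i <- s) `|c i| * `|dot y (g i)|.
  rewrite -[_ ^+ 2]ger0_norm ?exprn_ge0// {1}hdot {1}/y linear_sumlz.
  apply: le_trans (ler_norm_sum _ _ _) _; apply: ler_sum => i _.
  by rewrite linearZl_LR /= normrM (norm_dotC y).
have bessel_y : \sum_(i <- s) b^-1 * `|dot y (g i)| ^+ 2 <= `|y| ^+ 2.
  by rewrite -mulr_sumr mulrC ler_pdivrMr// mulrC.
rewrite -(lerD2r (`|y| ^+ 2)) -mulr2n.
apply: le_trans (lerD (lexx _) bessel_y).
rewrite mulr_sumr -big_split /=.
apply: (le_trans (y := (\sum_(i <- s) `|c i| * `|dot y (g i)|) *+ 2)).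
  by rewrite lerMn2r yE orbT.
rewrite -sumrMnl; apply: ler_sum => i _; exact: amgm.
Qed.

(** The Bessel inequality for T^* f, obtained without constructing T^* f: only
    its norm d, as a functional, enters. Testing f against the image under T of
    the vector synthesized from the coefficients <f, T g_i> themselves produces
    the sum of their squares. *)
Lemma image_coefficients_bound (I : Type) (s : seq I) (g : I -> H) (b d : K)
    (b0 : 0 < b) (d0 : 0 <= d)
    (bessel : forall x, \sum_(i <- s) `|dot x (g i)| ^+ 2 <= b * `|x| ^+ 2)
    (T : {linear H -> H}) (f : H)
    (fT : forall x, `|dot f (T x)| <= d * `|x|) :
  \sum_(i <- s) `|dot f (T (g i))| ^+ 2 <= d ^+ 2 * b.
Proof.
pose c i := dot f (T (g i)).
set S := \sum_(i <- s) _.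
have S0 : 0 <= S by apply: sumr_ge0 => i _; rewrite exprn_ge0.
pose y := \sum_(i <- s) c i *: g i.
have ye : `|y| ^+ 2 <= b * S by exact: synthesis_bound.
(* dot is conjugate-linear on the right, so c i comes out conjugated. *)
have SE : dot f (T y) = S.
  rewrite linear_sum linear_sumr; apply: eq_bigr => i _.
  by rewrite linearZ linearZr_LR /= mulrC conjE.
have Sle : S <= d * `|y| by rewrite -[S]ger0_norm// -SE.
have [->|Sn0] := eqVneq S 0; first by rewrite mulr_ge0 ?exprn_ge0// ltW.
have Sgt0 : 0 < S by rewrite lt_def Sn0.
rewrite -(ler_pM2r Sgt0) -expr2 -mulrA.
apply: (le_trans (y := (d * `|y|) ^+ 2)); first by rewrite lerXn2r// nnegrE mulr_ge0.
by rewrite exprMn ler_wpM2l// exprn_ge0.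
Qed.

Lemma exists_orthogonal (s : seq H) : ~ finite_dimensional H ->
  exists2 x : H, x != 0 & {in s, forall v, dot x v = 0}.
Proof.
move=> infH.
(* Finitely many e_i span H modulo the orthogonal complement of s; if that
   complement were 0, they would span H. *)
suff [n [e he]] : exists (n : nat) (e : 'I_n -> H), forall x,
    exists c : 'I_n -> K, {in s, forall v, dot (x - \sum_(i < n) c i *: e i) v = 0}.
  apply: contrapT => noz; apply: infH; exists n, e => x.
  have [c hc] := he x; exists c; apply/eqP; rewrite -subr_eq0.
  apply/negPn/negP => nz; apply: noz.
  by exists (x - \sum_(i < n) c i *: e i).
elim: s => [|v s [n [e he]]].
  by exists 0%N, (fun=> 0) => x; exists (fun=> 0).
have [[w ws wv]|now] :=
    pselect (exists2 w : H, {in s, forall u, dot w u = 0} & dot w v != 0).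
- (* w becomes the new generator of index 0, and its coefficient removes the
     component along v without disturbing orthogonality to s. *)
  exists n.+1, (fun i => oapp e w (unlift ord0 i)) => x.
  have [c hc] := he x; set y := x - _ in hc.
  exists (fun i => oapp c (dot y v / dot w v) (unlift ord0 i)).
  rewrite big_ord_recl unlift_none /=.
  under eq_bigr do rewrite liftK /=.
  rewrite opprD addrCA -/y addrC => u; rewrite linearBl linearZl_LR /= inE.
  by move=> /predU1P[->|us]; [rewrite divfK ?subrr|rewrite (hc _ us) (ws _ us) mulr0 subr0].
- exists n, e => x; have [c hc] := he x; exists c => u.
  rewrite inE => /predU1P[->|us]; last exact: hc.
  apply/eqP/negPn/negP => xv; apply: now.
  by exists (x - \sum_(i < n) c i *: e i).
Qed.

(** A vector orthogonal to a net of the image of the unit ball only sees the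
    distance from that image to the net. *)
Lemma compact_operator_small (T : {linear H -> H}) (f : H) (s : seq H) (e : K) :
  (forall x : H, `|x| <= 1 -> exists2 z, z \in s & `|T x - z| <= e) ->
  {in s, forall z, dot f z = 0} ->
  forall x, `|dot f (T x)| <= `|f| * e * `|x|.
Proof.
move=> net fs x; have [->|x0] := eqVneq x 0.
  by rewrite linear0 linear0r !normr0 mulr0.
have nx : 0 < `|x| by rewrite normr_gt0.
have [|z zs Txz] := net (`|x|^-1 *: x).
  by rewrite normrZ normfV normr_id mulVf// gt_eqF.
rewrite -ler_pdivrMr//.
have -> : `|dot f (T x)| / `|x| = `|dot f (T (`|x|^-1 *: x) - z)|.
  rewrite linearBr [X in _ - X](fs _ zs) subr0 linearZ linearZr_LR /= normrM norm_conj.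
  by rewrite normfV normr_id mulrC.
by apply: le_trans (cauchy_schwarz _ _) _; rewrite ler_wpM2l.
Qed.
End InnerProduct.

Lemma compact_operator_net (K : numFieldType) (U V : normedModType K)
    (T : {linear U -> V}) (e : K) : compact_operator T -> 0 < e ->
  exists s : seq V, forall x : U, `|x| <= 1 ->
    exists2 z, z \in s & `|T x - z| <= e.
Proof.
move=> cT e0; set A := [set x : U | `|x| <= 1].
have bA : bounded_set A.
  by exists 1; split=> // M M1 x /= /le_trans; apply; exact: ltW.
have := cT _ bA; rewrite precompactE compact_cover.
move=> /(_ V setT (fun z => (ball z e)°)) [].
- by move=> z _; exact: open_interior.
- by move=> z _; exists z => //; exact: nbhsx_ballx.
move=> D _ cov; exists (finmap.enum_fset D) => x x1.
have [|z /= zD /interior_subset] := cov (T x).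
  by apply: subset_closure; exists x.
by rewrite -ball_normE /= => xz; exists z => //; rewrite distrC ltW.
Qed.

(** The frame inequalities with values in K and finite sums. The infinite sum is
    a supremum of finite ones, so the lower bound reads: every common upper
    bound of the finite sums is at least a |f|^2. *)
Lemma frame_bounds (R : realType) (K : numFieldType)
    (conj : involutive_rmorphism K) (re : K -> R) (hK : scalar_field conj re)
    (H : normedModType K) (dot : {dot H for conj})
    (I : countType) (g : I -> H) : is_frame re dot g ->
  exists a b : K, [/\ 0 < a, 0 < b,
    forall (s : seq I), uniq s ->
      forall f, \sum_(i <- s) `|dot f (g i)| ^+ 2 <= b * `|f| ^+ 2
  & forall f c, (forall s : seq I, uniq s ->
      \sum_(i <- s) `|dot f (g i)| ^+ 2 <= c) -> a * `|f| ^+ 2 <= c].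
Proof.
have [iota [mono_iota reK _]] := scalar_field_embedding hK.
have iotaN2 (x : K) : iota (re `|x| ^+ 2) = `|x| ^+ 2 by rewrite rmorphXn reK.
move=> [A [B [A0 B0 frameP]]].
have iota_gt0 x : 0 < x -> 0 < iota x.
  by move=> x0; rewrite -(rmorph0 iota) (leW_mono mono_iota).
exists (iota A), (iota B); split; rewrite ?iota_gt0//.
- move=> s us f; have [_ up] := frameP f.
  have : (\sum_(i <- s) (re `|dot f (g i)| ^+ 2)%:E <= (B * re `|f| ^+ 2)%:E)%E.
    apply: le_trans up; rewrite fsbig_seq//; apply: ereal_sup_ubound.
    by exists [set` s] => //; split=> //; exact: finite_seq.
  rewrite sumEFin lee_fin -mono_iota rmorphM /= rmorph_sum /= rmorphXn /= reK//.
  by under eq_bigr do rewrite iotaN2.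
- move=> f c sums; have [low _] := frameP f.
  have c0 : 0 <= c by have := sums [::] isT; rewrite big_nil.
  have : ((A * re `|f| ^+ 2)%:E <= (re c)%:E)%E.
    apply: le_trans low _; apply: ub_ereal_sup => _ [F [finF _] <-].
    rewrite fsbig_finite//= sumEFin lee_fin -mono_iota reK ?ger0_real//.
    rewrite rmorph_sum /=; under eq_bigr do rewrite iotaN2.
    by apply: sums; exact: finmap.fset_uniq.
  by rewrite lee_fin -mono_iota rmorphM /= rmorphXn /= !reK ?ger0_real.
Qed.

Theorem proposition3p5 (R : realType) (K : numFieldType)
    (conj : involutive_rmorphism K) (re : K -> R)
    (hK : scalar_field conj re)
    (H : completeNormedModType K) (dot : {dot H for conj})
    (hdot : induces_norm dot)
    (hinf : ~ finite_dimensional H) (hsep : separable H)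
    (T : {linear H -> H}) (hT : compact_operator T)
    (J : nat) (phi : 'I_J -> H) :
  ~ is_frame re dot (fun jn : 'I_J * nat => iter jn.2 T (phi jn.1)).
Proof.
have [_ [_ _ conjE]] := scalar_field_embedding hK.
pose g (jn : 'I_J * nat) := iter jn.2 T (phi jn.1).
move=> /(frame_bounds (g := g) hK)[a [b [a0 b0 upper lower]]].
(* Any e with e^2 b < a will do; this one avoids square roots. *)
pose e := a / (a + b).
have ab0 : 0 < a + b by rewrite addr_gt0.
have e0 : 0 < e by rewrite divr_gt0.
have e2 : e ^+ 2 * b < a.
  have [e_ge0 b_ge0] := (ltW e0, ltW b0).
  have e1 : e < 1 by rewrite /e ltr_pdivrMr// mul1r ltrDl.
  have eb : e * b < a by rewrite /e mulrAC ltr_pdivrMr// ltr_pM2l// ltrDr.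
  by rewrite expr2 -mulrA -[ltRHS]mul1r ltr_pM// mulr_ge0.
have [net netP] := compact_operator_net hT e0.
have [f f0 forth] :=
  exists_orthogonal dot (net ++ [seq phi j | j <- enum 'I_J]) hinf.
have fphi j : dot f (phi j) = 0.
  by apply: forth; rewrite mem_cat map_f ?orbT// mem_enum.
have fT : forall x, `|dot f (T x)| <= `|f| * e * `|x|.
  apply: (compact_operator_small conjE hdot netP) => z zn.
  by apply: forth; rewrite mem_cat zn.
have : a * `|f| ^+ 2 <= (`|f| * e) ^+ 2 * b.
  apply: lower => s us.
  (* The terms of exponent 0 vanish; in the others one factor T is detached. *)
  pose prev (i : 'I_J * nat) := (i.1, i.2.-1).
  pose s' := [seq prev i | i <- s & (0 < i.2)%N].
  have us' : uniq s'.
    rewrite map_inj_in_uniq ?filter_uniq// => -[j [|n]] [k [|m]];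
      rewrite !mem_filter //= => _ _ [-> ->] //.
  have -> : \sum_(i <- s) `|dot f (g i)| ^+ 2 =
            \sum_(i <- s') `|dot f (T (g i))| ^+ 2.
    rewrite big_map big_filter [RHS]big_mkcond /=; apply: eq_bigr => -[j [|n]] _ //=.
    by rewrite /g /= fphi normr0 expr0n.
  apply: (image_coefficients_bound conjE hdot b0) fT.
    by rewrite mulr_ge0// ltW.
  exact: upper.
rewrite exprMn -mulrA mulrC ler_pM2l ?exprn_gt0 ?normr_gt0//.
by rewrite lt_geF.
Qed.
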